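(* Let $c_n$ be the number of $U_kD$-equivalence classes of the set $\mathcal{L}_n$ of Łukasiewicz paths of length $n$. Then $$\sum_{n\geq0}c_nx^n=\frac{1-x+x^2+\sqrt{1-2x-x^2-2x^3+x^4}}{1-2x-x^3+(1-x)\sqrt{1-2x-x^2-2x^3+x^4}},$$ and $c_n=a_{n+1}$ for all $n\geq 0$, where $a_0=1$ and $a_{m+1}=a_m+\sum_{k=1}^{m-1}a_ka_{m-1-k}$ for $m\geq 0$.
   Context: A Łukasiewicz path of length $n$ is a sequence of $n$ steps from $\{(1,i): i\geq -1\}$ starting at $(0,0)$, ending at $(n,0)$ and never going below the $x$-axis. Write $D=(1,-1)$, $F=(1,0)$, $U_k=(1,k)$ for $k\geq1$. Steps are numbered $1,\dots,n$; an occurrence of $U_kD$ is at position $i$ if its $U_k$ is the $i$-th step. Two Łukasiewicz paths of the same length are $U_kD$-equivalent if for every $k\geq1$ the set of occurrence positions of $U_kD$ is the same in both. *)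

(* Defs.v *)
From HB Require Import structures.
From mathcomp Require Import all_boot all_order all_algebra.
From mathcomp Require Import finmap.
From mathcomp Require Import boolp classical_sets functions cardinality.

Set Implicit Arguments.
Unset Strict Implicit.
Unset Printing Implicit Defensive.

Import Order.TTheory GRing.Theory Num.Theory.
Local Open Scope ring_scope.

(* A step (1, i) is represented by its rise i, so that D, F and U_k are -1, 0
   and k, and a path is the sequence of its rises. *)
Definition stepD : int := -1.
Definition stepU (k : nat) : int := k%:Z.

Definition lukasiewicz (n : nat) : set (seq int) :=
  [set w | [/\ size w = n,
               forall s : int, s \in w -> -1 <= s,
               \sum_(s <- w) s = 0 &
               forall i, (i <= n)%N -> 0 <= \sum_(s <- take i w) s]]%classic.

(* Steps are numbered from 1, while nth counts from 0. *)
Definition UD_positions (k : nat) (w : seq int) : set nat :=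
  [set i | [/\ (1 <= i < size w)%N,
               nth 0 w i.-1 = stepU k & nth 0 w i = stepD]]%classic.

Definition UD_equiv (v w : seq int) : Prop :=
  forall k, (1 <= k)%N -> UD_positions k v = UD_positions k w.

Definition UD_class (n : nat) (w : seq int) : set (seq int) :=
  [set v | lukasiewicz n v /\ UD_equiv w v]%classic.

Definition UD_classes (n : nat) : set (set (seq int)) :=
  [set UD_class n w | w in lukasiewicz n]%classic.

(* fset_set sends infinite sets to fset0; this case does not occur, by
   finite_UD_classes below. *)
Definition nb_UD_classes (n : nat) : nat := #|` fset_set (UD_classes n)|%fset.

Lemma finite_lukasiewicz n : finite_set (lukasiewicz n).
Proof.
pose f (t : n.-tuple 'I_n.+1) : seq int := [seq (j : nat)%:Z - 1 | j : 'I_n.+1 <- t].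
apply: (@sub_finite_set _ _ (f @` setT)%classic); last first.
  exact/finite_image/finite_finset.
move=> w [sz_w ge_w sum_w _].
have le_w s : s \in w -> s + 1 <= n%:Z.
  move=> sw; have := sum_w; rewrite (big_rem s) //= => sum_s.
  have : - (size (rem s w))%:Z <= \sum_(t <- rem s w) t.
    have : {subset rem s w <= w} by move=> t /mem_rem.
    elim: (rem s w) => [|t r IH] sub_r; first by rewrite big_nil.
    rewrite big_cons /= -add1n PoszD opprD lerD //.
      by apply/ge_w/sub_r; rewrite inE eqxx.
    by apply: IH => u ur; apply: sub_r; rewrite inE ur orbT.
  rewrite size_rem // sz_w.
  have n_gt0 : (0 < n)%N by rewrite -sz_w; case: (w) sw.
  have -> : \sum_(t <- rem s w) t = - s.
    by apply/eqP; rewrite -addr_eq0 addrC sum_s.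
  by rewrite lerN2 -[in n%:Z](prednK n_gt0) -addn1 PoszD lerD2r.
have sz : size [seq inord (absz (s + 1)) : 'I_n.+1 | s : int <- w] == n.
  by rewrite size_map sz_w.
exists (Tuple sz) => //; rewrite /f /= -map_comp -[RHS]map_id.
apply/eq_in_map => s sw /=.
have s1_ge0 : 0 <= s + 1 by rewrite -lerBlDr sub0r ge_w.
rewrite inordK; first by rewrite gez0_abs // addrK.
by rewrite ltnS -lez_nat gez0_abs // le_w.
Qed.

Lemma finite_UD_classes n : finite_set (UD_classes n).
Proof. exact/finite_image/finite_lukasiewicz. Qed.

Section StrongRec.
Variables (T : Type) (step : seq T -> T).

Fixpoint strong_rec_prefix (n : nat) : seq T :=
  if n is m.+1
  then rcons (strong_rec_prefix m) (step (strong_rec_prefix m)) else [::].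

(* The sequence u such that u n = step [:: u 0; ...; u n.-1]. *)
Definition strong_rec (n : nat) : T := step (strong_rec_prefix n).

Lemma size_strong_rec_prefix n : size (strong_rec_prefix n) = n.
Proof. by elim: n => //= n IH; rewrite size_rcons IH. Qed.

Lemma nth_strong_rec_prefix x0 n i :
  (i < n)%N -> nth x0 (strong_rec_prefix n) i = strong_rec i.
Proof.
elim: n => //= n IH; rewrite ltnS leq_eqVlt nth_rcons size_strong_rec_prefix.
by case/orP => [/eqP ->|lt_in]; rewrite ?ltnn ?eqxx // lt_in IH.
Qed.

End StrongRec.

(* Formal power series; a record, because functions into a ring already carry
   the pointwise ring structure. *)
Record fps (F : fieldType) := FPS { coef_fps :> nat -> F }.

Section FormalPowerSeries.
Variable F : fieldType.
Implicit Types f g h : fps F.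

HB.instance Definition _ := gen_eqMixin (fps F).
HB.instance Definition _ := gen_choiceMixin (fps F).

Lemma fpsP f g : (forall n, f n = g n) -> f = g.
Proof. by case: f g => [f] [g] /= /funext ->. Qed.

Definition fps_zero : fps F := FPS (fun=> 0).
Definition fps_one : fps F := FPS (fun n => (n == 0%N)%:R).
Definition fps_opp f : fps F := FPS (fun n => - f n).
Definition fps_add f g : fps F := FPS (fun n => f n + g n).
Definition fps_mul f g : fps F :=
  FPS (fun n => \sum_(i < n.+1) f i * g (n - i)%N).

Fact fps_addA : associative fps_add.
Proof. by move=> f g h; apply: fpsP => n /=; rewrite addrA. Qed.
Fact fps_addC : commutative fps_add.
Proof. by move=> f g; apply: fpsP => n /=; rewrite addrC. Qed.
Fact fps_add0 : left_id fps_zero fps_add.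
Proof. by move=> f; apply: fpsP => n /=; rewrite add0r. Qed.
Fact fps_addN : left_inverse fps_zero fps_opp fps_add.
Proof. by move=> f; apply: fpsP => n /=; rewrite addNr. Qed.

HB.instance Definition _ :=
  GRing.isZmodule.Build (fps F) fps_addA fps_addC fps_add0 fps_addN.

Fact coef_fps_mul_poly f g m n : (n <= m)%N ->
  fps_mul f g n = (\poly_(i < m.+1) f i * \poly_(i < m.+1) g i)`_n.
Proof.
move=> le_nm; rewrite coefM /=; apply: eq_bigr => i _.
by rewrite !coef_poly !ltnS (leq_trans _ le_nm) ?leq_ord //
           (leq_trans (leq_subr _ _) le_nm).
Qed.

Fact fps_mulC : commutative fps_mul.
Proof.
by move=> f g; apply: fpsP => n; rewrite !(coef_fps_mul_poly _ _ (leqnn n)) mulrC.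
Qed.
Fact fps_mulA : associative fps_mul.
Proof.
move=> f g h; apply: fpsP => n.
pose tr (u : fps F) := \poly_(i < n.+1) u i.
have -> : fps_mul f (fps_mul g h) n = (tr f * (tr g * tr h))`_n.
  rewrite coefM; apply: eq_bigr => i _.
  by rewrite coef_poly ltn_ord (coef_fps_mul_poly _ _ (leq_subr i n)).
have -> : fps_mul (fps_mul f g) h n = ((tr f * tr g) * tr h)`_n.
  rewrite coefM; apply: eq_bigr => i _.
  by rewrite coef_poly ltnS leq_subr (coef_fps_mul_poly _ _ (leq_ord i)).
by rewrite mulrA.
Qed.
Fact fps_mul1 : left_id fps_one fps_mul.
Proof.
move=> f; apply: fpsP => n /=; rewrite big_ord_recl /= mul1r subn0 big1 ?addr0 //.
by move=> i _; rewrite mul0r.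
Qed.
Fact fps_mulDl : left_distributive fps_mul fps_add.
Proof.
move=> f g h; apply: fpsP => n /=; rewrite -big_split.
by apply: eq_bigr => i _; rewrite mulrDl.
Qed.
Fact fps_one_neq0 : fps_one != 0 :> fps F.
Proof.
by apply/eqP => /(congr1 (fun f : fps F => f 0%N)) /eqP; rewrite /= oner_eq0.
Qed.

HB.instance Definition _ := GRing.Zmodule_isComNzRing.Build (fps F)
  fps_mulA fps_mulC fps_mul1 fps_mulDl fps_one_neq0.

Lemma coef_fps0 n : (0 : fps F) n = 0. Proof. by []. Qed.
Lemma coef_fps1 n : (1 : fps F) n = (n == 0%N)%:R. Proof. by []. Qed.
Lemma coef_fpsN f n : (- f) n = - f n. Proof. by []. Qed.
Lemma coef_fpsD f g n : (f + g) n = f n + g n. Proof. by []. Qed.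
Lemma coef_fpsB f g n : (f - g) n = f n - g n. Proof. by []. Qed.
Lemma coef_fpsM f g n : (f * g) n = \sum_(i < n.+1) f i * g (n - i)%N.
Proof. by []. Qed.

(* Division in MathComp is total: x^-1 = x when x is not a unit. *)
Definition fps_inv f : fps F :=
  if f 0%N == 0 then f else
  FPS (strong_rec (fun s =>
    (f 0%N)^-1 * ((size s == 0%N)%:R -
                  \sum_(i < size s) f (size s - i)%N * nth 0 s i))).

Fact fps_mulVf f : f 0%N != 0 -> fps_inv f * f = 1.
Proof.
move=> f0; apply: fpsP => n; rewrite coef_fpsM coef_fps1 /fps_inv (negbTE f0).
rewrite big_ord_recr /= subnn; set step := (X in strong_rec X).
have -> : strong_rec step n =
    (f 0%N)^-1 * ((n == 0%N)%:R - \sum_(i < n) f (n - i)%N * strong_rec step i).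
  rewrite [LHS]/(step (strong_rec_prefix step n)) -/step.
  rewrite size_strong_rec_prefix; congr (_ * (_ - _)).
  by apply: eq_bigr => i _; rewrite nth_strong_rec_prefix.
rewrite mulrC mulVKf // addrC -addrA -[RHS]addr0; congr (_ + _).
apply/eqP; rewrite addrC subr_eq0; apply/eqP/eq_bigr => i _.
by rewrite mulrC.
Qed.
Fact fps_unitPl f g : g * f = 1 -> f 0%N != 0.
Proof.
move=> /(congr1 (fun h : fps F => h 0%N)); rewrite coef_fpsM big_ord1 coef_fps1.
by apply: contra_eq_neq => ->; rewrite mulr0 eq_sym oner_neq0.
Qed.
Fact fps_inv_out f : ~~ (f 0%N != 0) -> fps_inv f = f.
Proof. by rewrite /fps_inv negbK => ->. Qed.

HB.instance Definition _ := GRing.ComNzRing_hasMulInverse.Build (fps F)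
  fps_mulVf fps_unitPl fps_inv_out.

Lemma fps_unitE f : (f \is a GRing.unit) = (f 0%N != 0).
Proof. by []. Qed.

Definition fpsX : fps F := FPS (fun n => (n == 1%N)%:R).

(* The square root with constant term 1 of a series f with
   constant term 1, obtained by solving s ^+ 2 = f for s n. *)
Definition fps_sqrt f : fps F :=
  FPS (strong_rec (fun s =>
    if size s == 0%N then 1 else
    (f (size s) - \sum_(1 <= i < size s) nth 0 s i * nth 0 s (size s - i)%N) / 2)).

Lemma fps_sqrt0 f : fps_sqrt f 0%N = 1.
Proof. by []. Qed.

Lemma fps_sqrtK f : 2 != 0 :> F -> f 0%N = 1 -> fps_sqrt f ^+ 2 = f.
Proof.
move=> nz2 f0; apply: fpsP => -[|n].
  by rewrite expr2 coef_fpsM big_ord1 !fps_sqrt0 mul1r f0.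
rewrite expr2 coef_fpsM big_ord_recl big_ord_recr /= subn0 subnn.
set step := (X in strong_rec X).
have -> : strong_rec step n.+1 = (f n.+1 -
    \sum_(i < n) strong_rec step i.+1 * strong_rec step (n - i)%N) / 2.
  rewrite [LHS]/(step (strong_rec_prefix step n.+1)) -/step.
  rewrite size_strong_rec_prefix big_add1 big_mkord; congr ((_ - _) / 2).
  apply: eq_bigr => i _.
  by rewrite !nth_strong_rec_prefix ?subSS ?ltnS ?leq_subr.
have -> : strong_rec step 0 = 1 by [].
rewrite mul1r mulr1 addrCA -mulr2n -[X in _ + X]mulr_natr divfK //.
by rewrite addrC subrK.
Qed.

End FormalPowerSeries.

Arguments fpsX {F}.

(* Main.v *)
(* Each U_kD-equivalence class contains exactly one path in which every U_k is
   followed by D and F only occurs at height 0: keep the occurrences of U_kD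
   and replace every other step by D at positive height and by F at height 0;
   this path stays weakly below the given one, so it also ends at height 0.
   If G counts these paths and A counts their descents by one level, then
   G = 1 + xG + x^2 G / (1 - A) and A = x + x^2 A / (1 - A); this system is
   solved by A = x + x^3 G with 1 / (1 - A) = 1 + xG, where
   G = 1 + xG + x^2 G (1 + xG). *)
Require Import Defs.
From mathcomp Require Import all_boot all_order all_algebra.
From mathcomp Require Import finmap.
From mathcomp Require Import boolp classical_sets cardinality.
From mathcomp Require Import zify ring.

Set Implicit Arguments.
Unset Strict Implicit.
Unset Printing Implicit Defensive.

Import Order.TTheory GRing.Theory Num.Theory.
Local Open Scope ring_scope.

(** * Paths from an arbitrary height and their occurrences of U_kD *)

(** The starting height is a parameter so that inductions can pass to suffixes of a path. *)
Fixpoint luk_from (h : int) (w : seq int) : bool :=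
  if w is s :: w' then [&& -1 <= s, 0 <= h + s & luk_from (h + s) w']
  else h == 0.

Lemma luk_fromP (h : int) (w : seq int) : 0 <= h ->
  luk_from h w <-> [/\ forall s : int, s \in w -> -1 <= s,
                       h + \sum_(s <- w) s = 0 &
                       forall i, (i <= size w)%N ->
                         0 <= h + \sum_(s <- take i w) s].
Proof.
elim: w h => [|s w IH] h h0 /=.
  rewrite big_nil addr0; split=> [/eqP ->|[_ -> //]].
  by split=> // i _; rewrite big_nil.
split=> [/and3P[s1 hs /(IH _ hs)[w1 sum_w take_w]]|[w1 sum_w take_w]].
  split=> [t||[|i] le_i]; rewrite ?big_cons ?addrA ?take0 ?big_nil ?addr0 //.
    by rewrite inE => /predU1P[->|/w1].
  exact: take_w.
have hs : 0 <= h + s by have := take_w 1%N isT; rewrite /= take0 big_seq1.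
rewrite w1 ?mem_head // hs; apply/IH => //; split=> [t tw||i le_i].
- by apply: w1; rewrite inE tw orbT.
- by move: sum_w; rewrite big_cons addrA.
- by have := take_w i.+1 le_i; rewrite /= big_cons addrA.
Qed.

Lemma lukasiewiczP (n : nat) (w : seq int) :
  lukasiewicz n w <-> size w = n /\ luk_from 0 w.
Proof.
split=> [[<- w1 sum_w take_w]|[<- /(luk_fromP _ (lexx 0))[w1 sum_w take_w]]].
  split=> //; apply/luk_fromP => //; split=> // [|i le_i]; rewrite add0r //.
  exact: take_w.
split=> // [|i le_i]; first by rewrite add0r in sum_w.
by have := take_w i le_i; rewrite add0r.
Qed.

(* No bound on i is needed: past the end of w, nth returns 0 and not D. *)
Definition same_UD (v w : seq int) : Prop :=
  forall i k : nat, (0 < k)%N ->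
    ((nth 0 v i == stepU k) && (nth 0 v i.+1 == stepD)) =
    ((nth 0 w i == stepU k) && (nth 0 w i.+1 == stepD)).

Lemma UD_positionsE (k : nat) (w : seq int) (i : nat) :
  UD_positions k w i.+1 <->
  (nth 0 w i == stepU k) && (nth 0 w i.+1 == stepD).
Proof.
split=> [[_ /= -> ->]|/andP[/eqP wi /eqP wi1]]; first by rewrite !eqxx.
by split=> //=; rewrite ltnNge; apply/negP => /(nth_default 0); rewrite wi1.
Qed.

Lemma UD_equivP (v w : seq int) : UD_equiv v w <-> same_UD v w.
Proof.
split=> [eq_vw i k k0|eq_vw k k0]; first apply/idP/idP.
- by move=> /UD_positionsE vi; apply/UD_positionsE; rewrite -eq_vw.
- by move=> /UD_positionsE vi; apply/UD_positionsE; rewrite eq_vw.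
apply/seteqP; split=> -[[]//|i] /UD_positionsE ud; apply/UD_positionsE.
  by rewrite -eq_vw.
by rewrite eq_vw.
Qed.

Lemma same_UD_behead (s t : int) (v w : seq int) :
  same_UD (s :: v) (t :: w) -> same_UD v w.
Proof. by move=> eq_vw i k k0; apply: (eq_vw i.+1). Qed.

(** * Canonical representatives of the classes *)

(* The length-n suffixes, from height h, of the representatives described above;
   bounding k loses nothing, as no suffix starts higher than its length. *)
Fixpoint greedy (n h : nat) : seq (seq int) :=
  if n is n1.+1 then
    (if h is h1.+1 then map (cons stepD) (greedy n1 h1)
     else map (cons 0) (greedy n1 0)) ++
    (if n1 is n2.+1 then
       [seq [:: stepU k.+1, stepD & v] | k <- iota 0 n1, v <- greedy n2 (h + k)]
     else [::])
  else if h is 0%N then [:: [::]] else [::].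

Definition low_step (h : nat) : int := if h is 0%N then 0 else stepD.

(** Since [0.-1 = 0], [h.-1] is the height after [low_step h] at every height, which merges the
    cases D and F. *)
Lemma greedySE (n h : nat) : greedy n.+1 h =
  map (cons (low_step h)) (greedy n h.-1) ++
  (if n is n2.+1 then
     [seq [:: stepU k.+1, stepD & v] | k <- iota 0 n, v <- greedy n2 (h + k)]
   else [::]).
Proof. by case: h. Qed.

Lemma greedy_height (n h : nat) (v : seq int) : v \in greedy n h -> (h <= n)%N.
Proof.
elim/ltn_ind: n h v => -[|n] IH h v; first by case: h.
rewrite greedySE mem_cat => /orP[/mapP[u /(IH _ (ltnSn n)) le_hn _]|].
  by case: h le_hn.
case: n IH => // n IH /allpairsPdep[k [u [_ /(IH n (leqnSn _)) le_hk _]]].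
by lia.
Qed.

Lemma greedy_low (n h : nat) (v : seq int) :
  v \in greedy n h.-1 -> low_step h :: v \in greedy n.+1 h.
Proof. by move=> vg; rewrite greedySE mem_cat map_f. Qed.

Lemma greedy_UD (n h k : nat) (v : seq int) :
  v \in greedy n (h + k) -> [:: stepU k.+1, stepD & v] \in greedy n.+2 h.
Proof.
move=> vg; rewrite greedySE mem_cat orbC.
by rewrite allpairs_f_dep // mem_iota /= add0n ltnS (leq_trans (leq_addl h k)) //
  (greedy_height vg).
Qed.

Variant greedy_spec (h : nat) : nat -> seq int -> Prop :=
| GreedyNil of h = 0%N : greedy_spec h 0 [::]
| GreedyLow n v of v \in greedy n h.-1 : greedy_spec h n.+1 (low_step h :: v)
| GreedyUD n k v of v \in greedy n (h + k) :
    greedy_spec h n.+2 [:: stepU k.+1, stepD & v].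

Lemma greedyP (n h : nat) (v : seq int) :
  v \in greedy n h -> greedy_spec h n v.
Proof.
case: n => [|n]; first by case: h => //=; rewrite inE => /eqP ->; apply: GreedyNil.
rewrite greedySE mem_cat => /orP[/mapP[u ug ->]|]; first exact: GreedyLow.
by case: n => // n /allpairsPdep[k [u [_ ug ->]]]; apply: GreedyUD.
Qed.

Lemma greedy_luk_from (n h : nat) (v : seq int) :
  v \in greedy n h -> size v = n /\ luk_from h%:Z v.
Proof.
elim/ltn_ind: n h v => n IH h v /greedyP v_n.
case: n v / v_n IH => [->|n v vg|n k v vg] IH //.
  rewrite /=; have [-> luk_v] := IH _ (ltnSn n) _ _ vg.
  split=> //=; case: h luk_v {vg} => //= h luk_v.
  by rewrite (_ : h.+1%:Z + stepD = h%:Z) // /stepD; lia.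
rewrite /=; have [-> luk_v] := IH _ (leqnSn n.+1) _ _ vg.
split=> //=; rewrite /stepU /stepD.
rewrite (_ : h%:Z + k.+1%:Z + -1 = (h + k)%N%:Z); last by lia.
by rewrite luk_v !andbT; lia.
Qed.

Lemma low_step_lt1 (h : nat) : low_step h < 1.
Proof. by case: h. Qed.

(** A [low_step] is never some U_k with k positive, so whether an occurrence sits at the first
    position, and for which k, determines how the word begins. *)
Lemma greedy_inj (n h : nat) (v w : seq int) :
  v \in greedy n h -> w \in greedy n h -> same_UD v w -> v = w.
Proof.
have low_UD (g k : nat) (u u' : seq int) :
    ~ same_UD (low_step g :: u) [:: stepU k.+1, stepD & u'].
  move=> /(_ 0%N k.+1 isT) /=; rewrite !eqxx /= => /andP[/eqP low_k _].
  by have := low_step_lt1 g; rewrite low_k.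
elim/ltn_ind: n h v w => n IH h v w /greedyP v_n w_n.
case: n v / v_n IH w_n => [h0|n v vg|n k v vg] IH w_n same_vw.
- by move: w_n; rewrite h0 inE => /eqP.
- move: w_n same_vw => /greedyP; move En: n.+1 => m w_n.
  case: m w / w_n En => // [m w wg [En]|m k w _ _ /low_UD //].
  by rewrite -En in wg => /same_UD_behead/(IH _ (ltnSn n) _ _ _ vg wg) ->.
move: w_n same_vw => /greedyP; move En: n.+2 => m w_n.
case: m w / w_n En => // [m w _ _ same_wv|m j w wg [En]].
  by case: (low_UD h k w v) => i l l0; rewrite same_wv.
move=> same_vw; have /esym := same_vw 0%N k.+1 isT.
rewrite /= !eqxx andbT /= => /eqP[Ek].
rewrite -En Ek in wg *.
move: same_vw => /same_UD_behead/same_UD_behead.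
by move=> /(IH n (leqnSn n.+1) _ _ _ vg wg) ->.
Qed.

(** The inequality [h%:Z <= H] is an invariant: a kept U_kD shifts both heights equally, and any
    other step lowers [H] by at most one and leaves it nonnegative. At the end [H = 0] forces
    [h = 0]. *)
Lemma greedy_below (w : seq int) (h : nat) (H : int) :
  h%:Z <= H -> luk_from H w ->
  exists2 v, v \in greedy (size w) h & same_UD w v.
Proof.
move Ew: (size w) => n.
elim/ltn_ind: n w Ew h H => n IH [|s w] En h H le_hH /= luk_w.
  by exists [::] => //; rewrite -En; case: h le_hH => // h; rewrite (eqP luk_w).
case/and3P: luk_w => s1 Hs luk_w; rewrite -En.
have [[k k0 [u sE wE]]|noUD] := pselect (exists2 k : nat, (0 < k)%N &
    exists2 u, s = stepU k & w = stepD :: u).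
  rewrite {}sE {}wE /= in luk_w En *; case/andP: luk_w => _ luk_u.
  case: k k0 => // k _ in luk_u *.
  have [||v vg same_uv] := IH (size u) _ u erefl (h + k)%N _ _ luk_u.
  - by rewrite -En.
  - by rewrite /stepU /stepD; lia.
  exists [:: stepU k.+1, stepD & v]; first exact: greedy_UD.
  by move=> [|[|i]] // j j0; apply: (same_uv i).
have [||v vg same_wv] := IH (size w) _ w erefl h.-1 _ _ luk_w.
- by rewrite -En.
- by case: h le_hH => [|h] /= le_hH; lia.
exists (low_step h :: v); first exact: greedy_low.
(* At the first position neither word has an occurrence: [noUD] excludes it in the given path,
   [low_step h < 1] in the new one. *)
move=> [|i] k k0; last exact: same_wv.
rewrite /= [RHS](_ : _ = false); last first.
  apply/negbTE/nandP; left; apply: contraTneq (low_step_lt1 h) => ->.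
  by rewrite -leNgt /stepU; lia.
apply/negP => /andP[/eqP sk /eqP wD]; case: noUD.
by exists k => //; exists (behead w) => //; case: (w) wD => //= t u ->.
Qed.

Lemma greedy_uniq (n h : nat) : uniq (greedy n h).
Proof.
elim/ltn_ind: n h => -[|n] IH h; first by case: h.
rewrite greedySE cat_uniq map_inj_uniq ?IH //=; last by move=> ? ? [].
case: n IH => // n IH; apply/andP; split.
  apply/hasPn => _ /allpairsPdep[k [v [_ _ ->]]]; apply/mapP => -[u _ [Ek _]].
  by have := low_step_lt1 h; rewrite -Ek.
apply: allpairs_uniq_dep => [|k _|]; rewrite ?iota_uniq ?IH //.
by move=> [k u] [l v] _ _ /= [-> ->].
Qed.

(** [UD_class n] maps the representatives onto the classes by [greedy_below], and injectively by
    [greedy_inj]. *)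
Lemma nb_UD_classes_greedy (n : nat) : nb_UD_classes n = size (greedy n 0).
Proof.
rewrite /nb_UD_classes.
have -> : fset_set (UD_classes n) = seq_fset tt (map (UD_class n) (greedy n 0)).
  apply/fsetP => C; rewrite in_fset_set ?seq_fsetE; last exact: finite_UD_classes.
  apply/idP/mapP => [|[v /greedy_luk_from v_luk ->]].
    rewrite inE => -[w /lukasiewiczP[sz_w luk_w] <-].
    have [v vg same_wv] := greedy_below (lexx 0%N%:Z) luk_w.
    exists v; first by rewrite -sz_w.
    have /UD_equivP eq_wv := same_wv.
    by apply/seteqP; split=> u [u_luk eq_u]; split=> // k k0;
      rewrite -eq_u // eq_wv.
  by rewrite inE; exists v => //; apply/lukasiewiczP.
rewrite size_seq_fset undup_id ?size_map // map_inj_in_uniq ?greedy_uniq //.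
move=> v w vg wg eq_vw; apply: (greedy_inj vg wg); apply/UD_equivP.
have : UD_class n w w by split=> //; apply/lukasiewiczP/(@greedy_luk_from _ 0).
by rewrite -eq_vw => -[].
Qed.

(** * Generating functions *)

Lemma coef_fpsXM (F : fieldType) (f : fps F) (n : nat) :
  (fpsX * f) n = if n is m.+1 then f m else 0.
Proof.
rewrite coef_fpsM; case: n => [|n]; first by rewrite big_ord1 mul0r.
rewrite big_ord_recl mul0r add0r big_ord_recl mul1r subSS subn0 big1 ?addr0 //.
by move=> i _; rewrite mul0r.
Qed.

Lemma coef_fpsXnM (F : fieldType) (f : fps F) (k n : nat) :
  (n < k)%N -> (fpsX ^+ k * f) n = 0.
Proof.
elim: k n => // k IH n lt_nk; rewrite exprS -mulrA coef_fpsXM.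
by case: n lt_nk => // n; apply: IH.
Qed.

(** A suffix from height [h] splits into [h] first passages one level down, each counted by
    [x + x ^+ 3 * G], and a path from height 0. *)
Lemma size_greedy_fps (F : fieldType) (G : fps F) (n h : nat) :
  let x := fpsX in
  G = 1 + x * G + x ^+ 2 * G + x ^+ 3 * G ^+ 2 ->
  (size (greedy n h))%:R = ((x + x ^+ 3 * G) ^+ h * G) n.
Proof.
move=> x eqG; set A := x + x ^+ 3 * G.
(* Since (1 - A)^-1 = 1 + xG, S h is the sum of the A^j G over all j >= h. *)
pose S h := A ^+ h * ((1 + x * G) * G).
have eqA : A * (1 + x * G) = x * G by rewrite [X in _ = _ * X]eqG /A; ring.
(* This mirrors [greedySE]: [S j] gathers the continuations after an initial U_kD. *)
have step_low j : A ^+ j * G = (j == 0%N)%:R + x * (A ^+ j.-1 * G + x * S j).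
  case: j => [|j]; first by rewrite /S /= !expr0 !mul1r {1}eqG; ring.
  by rewrite /= /S exprSr -!mulrA [A * ((1 + _) * _)]mulrA eqA /A; ring.
(* [A] is divisible by [x]; hence the telescoping sum over the bounded range of k already gives all
   of [S h]. *)
have S_low j m : (m < j)%N -> S j m = 0.
  rewrite /S (_ : A = x * (1 + x ^+ 2 * G)); last by rewrite /A; ring.
  by move=> lt_mj; rewrite exprMn -mulrA coef_fpsXnM.
have S_step j m : (A ^+ j * G) m = S j m - S j.+1 m.
  rewrite -coef_fpsB /S exprSr -!mulrA [A * ((1 + _) * _)]mulrA eqA.
  by congr (coef_fps _ m); ring.
elim/ltn_ind: n h => -[|n] IH h.
  by rewrite step_low coef_fpsD coef_fpsXM addr0; case: h.
rewrite greedySE size_cat size_map natrD IH // [in RHS]step_low coef_fpsD.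
rewrite coef_fpsXM.
rewrite (_ : _ n.+1 = 0) ?add0r; last by case: (h).
rewrite coef_fpsD coef_fpsXM; congr (_ + _).
case: n IH => // n IH.
rewrite size_allpairs_dep sumnE big_map natr_sum.
under eq_bigr => k _ do rewrite IH // S_step -addnS.
rewrite -[iota 0 _]/(index_iota 0 n.+1).
rewrite -[LHS]opprK -sumrN; under eq_bigr do rewrite opprB.
rewrite (telescope_sumr (fun k => S (h + k)%N n)) //.
by rewrite opprB addn0 (S_low (h + n.+1)%N) ?subr0 // addnS ltnS leq_addl.
Qed.

(** Subtracting the equations leaves [u * (f - g) = 0], where [u] has constant term 1. *)
Lemma fps_rec_unique (F : fieldType) (f g : fps F) :
  let x := fpsX in
  f = 1 + x * f + x ^+ 2 * ((f - 1) * f) ->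
  g = 1 + x * g + x ^+ 2 * ((g - 1) * g) -> f = g.
Proof.
move=> x eqf eqg; pose u := 1 - x * (1 + x * (f + g - 1)).
have u_unit : u \is a GRing.unit.
  by rewrite fps_unitE coef_fpsB coef_fpsXM subr0 oner_neq0.
apply/eqP; rewrite -subr_eq0 -(mulrI_eq0 _ (mulrI u_unit)); apply/eqP.
transitivity ((f - x * f - x ^+ 2 * ((f - 1) * f)) -
              (g - x * g - x ^+ 2 * ((g - 1) * g))); first by rewrite /u; ring.
by rewrite {1}eqf {1}eqg; ring.
Qed.

(** The factor [f - 1] reflects that the convolution starts at k = 1. *)
Lemma fps_of_rec (F : fieldType) (a : nat -> nat) :
  a 0%N = 1%N ->
  (forall m, a m.+1 = (a m + \sum_(1 <= k < m) a k * a (m.-1 - k))%N) ->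
  let x : fps F := fpsX in let f := FPS (fun n => (a n)%:R) in
  f = 1 + x * f + x ^+ 2 * ((f - 1) * f).
Proof.
move=> a0 aS x f; rewrite expr2 -mulrA -addrA -mulrDr; apply: fpsP => -[|n].
  by rewrite coef_fpsD coef_fpsXM addr0 /= a0.
rewrite coef_fpsD coef_fpsXM coef_fpsD coef_fpsXM coef_fps1 add0r.
rewrite [LHS]/= aS natrD.
congr (_ + _); case: n => [|n]; first by rewrite big_geq.
rewrite coef_fpsM big_ord_recl coef_fpsB [f _]/= a0 subrr mul0r add0r.
rewrite big_add1 big_mkord natr_sum; apply: eq_bigr => i _.
by rewrite coef_fpsB subr0 natrM.
Qed.

(** Multiplying by [D ^+ 2] leaves a polynomial identity in [x] and [S], true modulo the value of
    [S ^+ 2]. *)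
Lemma closed_form_eq (F : fieldType) : 2 != 0 :> F ->
  let x : fps F := fpsX in
  let S := fps_sqrt (1 - 2 * x - x ^+ 2 - 2 * x ^+ 3 + x ^+ 4) in
  let G := (1 - x + x ^+ 2 + S) / (1 - 2 * x - x ^+ 3 + (1 - x) * S) in
  G = 1 + x * G + x ^+ 2 * G + x ^+ 3 * G ^+ 2.
Proof.
move=> nz2 x S; set N := _ + S; set D := _ + _ * S => G.
have x0 (f : fps F) : (x * f) 0%N = 0 by rewrite coef_fpsXM.
have sqrS : S ^+ 2 = 1 - 2 * x - x ^+ 2 - 2 * x ^+ 3 + x ^+ 4.
  apply: fps_sqrtK => //.
  rewrite (_ : _ + _ = 1 + x * (x ^+ 3 - 2 * x ^+ 2 - x - 2)); last by ring.
  by rewrite coef_fpsD x0 addr0.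
have D_unit : D \is a GRing.unit.
  (* This form shows that [D] has constant term 2. *)
  rewrite fps_unitE (_ : D = 1 + S - x * (2 + x ^+ 2 + S)); last by rewrite /D; ring.
  by rewrite coef_fpsB x0 subr0 coef_fpsD fps_sqrt0.
have GD : G * D = N by rewrite divrK.
apply: (mulIr D_unit); apply: (mulIr D_unit).
transitivity (G * D * D); first by ring.
transitivity (D ^+ 2 + (x + x ^+ 2) * (G * D) * D + x ^+ 3 * (G * D) ^+ 2);
  last by ring.
by rewrite GD /N /D; ring: sqrS.
Qed.

Theorem theorem8 :
  (let x : fps rat := fpsX in
   let S := fps_sqrt (1 - 2 * x - x ^+ 2 - 2 * x ^+ 3 + x ^+ 4) in
   FPS (fun n => (nb_UD_classes n)%:R : rat) =
     (1 - x + x ^+ 2 + S) / (1 - 2 * x - x ^+ 3 + (1 - x) * S))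
  /\
  (forall a : nat -> nat,
     a 0%N = 1%N ->
     (forall m, a m.+1 = (a m + \sum_(1 <= k < m) a k * a (m.-1 - k))%N) ->
     forall n, nb_UD_classes n = a n.+1).
Proof.
have /= := @closed_form_eq rat isT.
set x := fpsX; set S := fps_sqrt _; set G := _ / _ => eqG.
have nbG n : (nb_UD_classes n)%:R = G n.
  by rewrite nb_UD_classes_greedy (size_greedy_fps _ _ eqG) expr0 mul1r.
split=> [|a a0 aS n]; first exact: fpsP.
have eq_f := fps_of_rec rat a0 aS.
(* By [eqG], [1 + x * G] solves the equation of the series of [a]; the factor [x] gives the index
   shift. *)
have : FPS (fun n => (a n)%:R) = 1 + x * G.
  apply: fps_rec_unique => //=; rewrite -/x {1}eqG; ring.
move=> /(congr1 (fun f : fps rat => f n.+1)).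
by rewrite coef_fpsD coef_fpsXM add0r -nbG => /eqP; rewrite eqr_nat => /eqP.
Qed.
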